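(* Let $f$ be a quadratic vector field on $\mathbb{R}^n$ with $\operatorname{div} f=0$. Suppose there exists a Darboux polynomial in aromas $B(\gamma)$ (with cofactor $\det D\Phi_h$, where $\Phi_h$ is the Kahan map of $f$) with $\gamma(\mathbf 1)=1$. Then there is a constant $\alpha\in\mathbb{R}$ such that $$F(C_3)=\alpha\,F(T),$$ i.e. $\sum_{i,j,k} f^i_jf^j_kf^k_i=\alpha\sum_{i,j,k} f^i_j f^j_{ik}f^k$ as functions on $\mathbb{R}^n$. Furthermore, for such an $\alpha$, either both $F(C_3)$ and $F(T)$ are identically zero, or $$\gamma(C_2)=\frac{\alpha-3}{12}.$$
   Context: **Kahan map.** A quadratic vector field on $\mathbb{R}^n$ is an $f:\mathbb{R}^n\to\mathbb{R}^n$ whose components are polynomials of degree at most 2. Its Kahan map with step size $h$ is $$\Phi_h(x)=x+h\left(I-\tfrac h2 f'(x)\right)^{-1}f(x),$$ where $f'$ is the Jacobian matrix. It satisfies $\det D\Phi_h(x)=\dfrac{\det(I+\frac h2 f'(\Phi_h(x)))}{\det(I-\frac h2 f'(x))}$. **Aromas.** An aroma is a finite connected directed graph (self-loops allowed) in which every vertex has exactly one outgoing edge; it contains exactly one directed cycle. $\mathcal A$ denotes the set of finite multisets (disjoint unions) of aromas, up to isomorphism, and $\mathbf 1\in\mathcal A$ is the empty multiset. For $\alpha\in\mathcal A$, $|\alpha|$ is the number of vertices and $\sigma(\alpha)$ is the number of automorphisms of the directed graph $\alpha$. **Aromatic functions.** For $\alpha\in\mathcal A$, label the vertices of $\alpha$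 by indices. To a vertex with label $j$, whose incoming edges come from the vertices labelled $i_1,\dots,i_m$, associate $f^j_{i_1\cdots i_m}=\partial^m f^j/\partial x_{i_1}\cdots\partial x_{i_m}$. The function $F(\alpha):\mathbb{R}^n\to\mathbb{R}$ is the product of these factors over all vertices, with every index summed from $1$ to $n$; $F(\mathbf 1)=1$. **Particular aromas.** $C_2$ is the directed 2-cycle, so $F(C_2)=\operatorname{tr}((f')^2)$. $C_3$ is the directed 3-cycle, so $F(C_3)=\operatorname{tr}((f')^3)=\sum_{i,j,k} f^i_jf^j_kf^k_i$. $T$ is the aroma on three vertices consisting of a directed 2-cycle on vertices $i,j$ and a third vertex $k$ with an edge from $k$ to $j$, so $F(T)=\sum_{i,j,k} f^i_jf^j_{ik}f^k$. **Aromatic series and Darboux polynomials.** For $\gamma:\mathcal A\to\mathbb{R}$ (independent of $h$ and $x$), the aromatic series is $$B(\gamma)=\sum_{\alpha\in\mathcal A}\frac{h^{|\alpha|}\gamma(\alpha)}{\sigma(\alpha)}F(\alpha),$$ viewed as a formal power series in $h$ whose coefficients are polynomial functions of $x$. $P=B(\gamma)$ is called a Darboux polynomial in aromas (with cofactor $\det D\Phi_h$) if $P\circ\Phi_h=\det(D\Phi_h)\cdot P$, i.e. $$\det\left(I-\tfrac h2 f'(x)\right)P(\Phi_h(x))=P(x)\det\left(I+\tfrac h2 f'(\Phi_h(x))\right),$$ as an identity of power series in $h$ (each power of $h$ separately), where $\Phi_h(x)=x+\sum_{k\ge0}\frac{h^{k+1}}{2^k}(f'(x))^kf(x)$. *)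

(* Defs.v *)
From HB Require Import structures.
From mathcomp Require Import all_boot all_order all_fingroup all_algebra.
From mathcomp Require Import boolp reals.
From mathcomp Require Import mpoly.

Set Implicit Arguments.
Unset Strict Implicit.
Unset Printing Implicit Defensive.

Import GRing.Theory.

Local Open Scope ring_scope.

Record fps (A : Type) := FPS { fpscoef : nat -> A }.

Lemma fpsP (A : Type) (a b : fps A) : fpscoef a =1 fpscoef b -> a = b.
Proof. by case: a b => [a] [b] /= /funext ->. Qed.

HB.instance Definition _ (A : Type) := gen_eqMixin (fps A).
HB.instance Definition _ (A : Type) := gen_choiceMixin (fps A).

(* Locked: otherwise unification may diverge on products of series. *)
HB.lock Definition fps_mul (A : comNzRingType) (a b : fps A) : fps A :=
  FPS (fun k => \sum_(i < k.+1) fpscoef a i * fpscoef b (k - i)%N).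

Section FpsRing.
Variable A : comNzRingType.
Implicit Types a b c : fps A.
Local Notation fps_mul := (@fps_mul A).

Definition fpsC (x : A) : fps A := FPS (fun k => if k == 0%N then x else 0).
Definition fpsh : fps A := FPS (fun k => (k == 1%N)%:R).

Definition fps_add a b := FPS (fun k => fpscoef a k + fpscoef b k).
Definition fps_opp a := FPS (fun k => - fpscoef a k).

Fact fps_addA : associative fps_add.
Proof. by move=> a b c; apply: fpsP => k /=; rewrite addrA. Qed.
Fact fps_addC : commutative fps_add.
Proof. by move=> a b; apply: fpsP => k /=; rewrite addrC. Qed.
Fact fps_add0 : left_id (fpsC 0) fps_add.
Proof. by move=> a; apply: fpsP => k /=; rewrite if_same add0r. Qed.
Fact fps_addN : left_inverse (fpsC 0) fps_opp fps_add.
Proof. by move=> a; apply: fpsP => k /=; rewrite if_same addNr. Qed.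

HB.instance Definition _ :=
  GRing.isZmodule.Build (fps A) fps_addA fps_addC fps_add0 fps_addN.

Let trunc N a := \poly_(i < N) fpscoef a i.

Let fps_mulE N a b k : (k < N)%N ->
  fpscoef (fps_mul a b) k = (trunc N a * trunc N b)`_k.
Proof.
move=> kN; rewrite fps_mul.unlock coefM; apply: eq_bigr => i _.
by rewrite !coef_poly !(leq_ltn_trans _ kN) ?leq_subr // -ltnS.
Qed.

Fact fps_mulA : associative fps_mul.
Proof.
move=> a b c; apply: fpsP => k.
rewrite !(@fps_mulE k.+1) // !coefM.
transitivity (trunc k.+1 a * (trunc k.+1 b * trunc k.+1 c))`_k.
  rewrite coefM; apply: eq_bigr => i _.
  by rewrite [(trunc _ (fps_mul _ _))`_ _]coef_poly ltnS leq_subr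
             (@fps_mulE k.+1) // ltnS leq_subr.
rewrite mulrA coefM; apply: eq_bigr => i _.
by rewrite [(trunc _ (fps_mul _ _))`_ _]coef_poly ltn_ord (@fps_mulE k.+1).
Qed.
Fact fps_mulC : commutative fps_mul.
Proof. by move=> a b; apply: fpsP => k; rewrite !(@fps_mulE k.+1) // mulrC. Qed.
Fact fps_mul1 : left_id (fpsC 1) fps_mul.
Proof.
move=> a; apply: fpsP => k; rewrite fps_mul.unlock /= big_ord_recl /= mul1r subn0.
by rewrite big1 ?addr0 // => i _; rewrite mul0r.
Qed.
Fact fps_mulDl : left_distributive fps_mul +%R.
Proof.
move=> a b c; apply: fpsP => k; rewrite fps_mul.unlock /= -big_split /=.
by apply: eq_bigr => i _; rewrite mulrDl.
Qed.
Fact fps_oner_neq0 : fpsC 1 != 0.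
Proof.
apply/eqP => /(congr1 (fun a => fpscoef a 0)) /= /eqP.
by rewrite oner_eq0.
Qed.

HB.instance Definition _ := GRing.Zmodule_isComNzRing.Build (fps A)
  fps_mulA fps_mulC fps_mul1 fps_mulDl fps_oner_neq0.

Lemma fpscoefB a b k : fpscoef (a - b) k = fpscoef a k - fpscoef b k.
Proof. by []. Qed.

Lemma fpscoefC x k : fpscoef (fpsC x) k = if k == 0%N then x else 0.
Proof. by []. Qed.

Lemma fpscoefM a b k :
  fpscoef (a * b) k = \sum_(i < k.+1) fpscoef a i * fpscoef b (k - i)%N.
Proof. by rewrite -[a * b]/(fps_mul a b) fps_mul.unlock. Qed.

Lemma fpscoefCM x a k : fpscoef (fpsC x * a) k = x * fpscoef a k.
Proof.
rewrite fpscoefM big_ord_recl /= subn0 big1 ?addr0 // => i _.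
by rewrite mul0r.
Qed.

Lemma fpscoefhM a k :
  fpscoef (fpsh * a) k = if k is k'.+1 then fpscoef a k' else 0.
Proof.
case: k => [|k]; first by rewrite fpscoefM big_ord1 mul0r.
rewrite fpscoefM big_ord_recl mul0r add0r big_ord_recl mul1r big1 ?addr0 ?subn1 //.
by move=> i _; rewrite mul0r.
Qed.

Lemma fpscoef_sum (I : Type) (r : seq I) (P : pred I) (F : I -> fps A) k :
  fpscoef (\sum_(i <- r | P i) F i) k = \sum_(i <- r | P i) fpscoef (F i) k.
Proof.
by apply: (big_morph (fun a => fpscoef a k)) => //=; rewrite if_same.
Qed.

End FpsRing.

Arguments fpsh {A}.

(* A finite digraph on 'I_N in which every vertex has exactly one outgoing
   edge, given by its successor function: the edges are i --> phi i.  The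
   connected components of such a digraph are aromas, so these digraphs are
   exactly the disjoint unions of aromas with N vertices. *)
Definition outgraph (N : nat) := {ffun 'I_N -> 'I_N}.

Definition is_iso N (phi psi : outgraph N) (s : 'S_N) :=
  [forall i, s (phi i) == psi (s i)].

Definition isomorphic N : rel (outgraph N) :=
  fun phi psi => [exists s, is_iso phi psi s].

Lemma isomorphic_refl N : reflexive (@isomorphic N).
Proof.
by move=> phi; apply/existsP; exists 1%g; apply/forallP => i; rewrite !perm1.
Qed.

Lemma isomorphic_imp N phi psi : @isomorphic N phi psi -> isomorphic psi phi.
Proof.
case/existsP => s /forallP sP; apply/existsP; exists (s^-1)%g; apply/forallP => i.
by apply/eqP/(@perm_inj _ s); rewrite (eqP (sP _)) !permKV.
Qed.

Lemma isomorphic_sym N : ssrbool.symmetric (@isomorphic N).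
Proof. by move=> phi psi; apply/idP/idP; apply: isomorphic_imp. Qed.

Lemma isomorphic_trans N : transitive (@isomorphic N).
Proof.
move=> psi phi chi /existsP[s /forallP sP] /existsP[t /forallP tP].
apply/existsP; exists (s * t)%g; apply/forallP => i.
by rewrite !permM (eqP (sP i)) tP.
Qed.

Canonical isomorphic_equiv N := EquivRel (@isomorphic N)
  (@isomorphic_refl N) (@isomorphic_sym N) (@isomorphic_trans N).

Definition aromas_of_order (N : nat) := {eq_quot @isomorphic_equiv N}%qT.

HB.instance Definition _ N := Choice.on (aromas_of_order N).
HB.instance Definition _ N := EqQuotient.on (aromas_of_order N).
HB.instance Definition _ N : isCountable (aromas_of_order N) :=
  CanIsCountable (@reprK (outgraph N) (aromas_of_order N)).
HB.instance Definition _ N : isFinite (aromas_of_order N) :=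
  CanIsFinite (@reprK (outgraph N) (aromas_of_order N)).

Definition aromas := {N : nat & aromas_of_order N}.

Definition aromas_class N (phi : outgraph N) : aromas :=
  Tagged aromas_of_order (\pi_(aromas_of_order N) phi)%qT.

Definition aromas_repr N (a : aromas_of_order N) : outgraph N :=
  generic_quotient.repr a.

Definition outgraph0 : outgraph 0 := [ffun i => i].
Definition C2 : outgraph 2 := [ffun i : 'I_2 => ordS i].
Definition C3 : outgraph 3 := [ffun i : 'I_3 => ordS i].
(* 0 --> 1, 1 --> 0, 2 --> 1 *)
Definition Taroma : outgraph 3 := [ffun i : 'I_3 => inord (i != 1%N :> nat)].

Definition nb_aut N (phi : outgraph N) : nat := #|[set s | is_iso phi phi s]|.

Lemma nb_aut_iso N (phi psi : outgraph N) :
  isomorphic phi psi -> nb_aut phi = nb_aut psi.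
Proof.
case/existsP => t /forallP tP.
have t'P i : phi ((t^-1)%g i) = (t^-1)%g (psi i).
  by apply/(@perm_inj _ t); rewrite (eqP (tP _)) !permKV.
rewrite /nb_aut -(card_imset _ (@conjg_inj _ t)); apply: eq_card => s.
rewrite inE; apply/imsetP/forallP => [[u] | sP].
  rewrite inE => /forallP uP -> i.
  by rewrite !permM -t'P (eqP (uP _)) (eqP (tP _)).
exists (s ^ t^-1)%g; last by rewrite conjgKV.
by rewrite inE; apply/forallP => i;
   rewrite conjgE invgK !permM t'P -(eqP (sP _)) (eqP (tP _)).
Qed.

Section VectorField.
Variables (R : realType) (n : nat) (f : 'cV[{mpoly R[n]}]_n).

(* msize is the degree plus one *)
Definition quadratic := forall i, (msize (f i ord0) <= 3)%N.

Definition divergence : {mpoly R[n]} := \sum_i (f i 0)^`M(i).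

Definition jacobian : 'M[{mpoly R[n]}]_n := \matrix_(i, j) (f i 0)^`M(j).

(* The inner multi-index collects the labels of the predecessors of j. *)
Definition elemF N (phi : outgraph N) : {mpoly R[n]} :=
  \sum_(l : {ffun 'I_N -> 'I_n})
    \prod_(j < N) (f (l j) 0)^`M[(\sum_(i < N | phi i == j) U_(l i))%MM].

Lemma elemF_iso N (phi psi : outgraph N) :
  isomorphic phi psi -> elemF phi = elemF psi.
Proof.
case/existsP => t /forallP tP.
have ffK (u : 'S_N) : cancel (fun l : {ffun 'I_N -> 'I_n} => [ffun i => l (u i)])
                             (fun l => [ffun i => l ((u^-1)%g i)]).
  by move=> l; apply/ffunP => i; rewrite !ffunE permKV.
rewrite /elemF (reindex_inj (can_inj (ffK t))) /=.
apply: eq_bigr => l _; rewrite [RHS](reindex_inj (@perm_inj _ t)) /=.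
apply: eq_bigr => j _; rewrite ffunE; congr (_ ^`M[_]).
rewrite [RHS](reindex_inj (@perm_inj _ t)) /=.
apply: eq_big => i; last by rewrite ffunE.
by rewrite -(eqP (tP i)) (inj_eq (@perm_inj _ t)).
Qed.

Definition aromatic_series (gamma : aromas -> R) : fps {mpoly R[n]} :=
  FPS (fun N => \sum_(a : aromas_of_order N)
    (gamma (Tagged aromas_of_order a) / (nb_aut (aromas_repr a))%:R)
      *: elemF (aromas_repr a)).

(* Geometric expansion in h of Phi_h = x + h (I - h/2 f')^-1 f; see kahanE. *)
Definition kahan (i : 'I_n) : fps {mpoly R[n]} :=
  FPS (fun m => if m is k.+1
    then (2%:R ^+ k)^-1 *: (jacobian ^+ k *m f) i 0 else 'X_i).

Definition mpoly_subst (Phi : 'I_n -> fps {mpoly R[n]}) (p : {mpoly R[n]}) :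
    fps {mpoly R[n]} :=
  mmap (fun c => fpsC c%:MP) Phi p.

(* \sum_m h^m * (P_m)(Phi): the coefficient of h^k only involves m <= k. *)
Definition fps_subst (Phi : 'I_n -> fps {mpoly R[n]}) (P : fps {mpoly R[n]}) :
    fps {mpoly R[n]} :=
  FPS (fun k => \sum_(m < k.+1)
    fpscoef (mpoly_subst Phi (fpscoef P m)) (k - m)).

Definition half_h : fps {mpoly R[n]} := fpsC (2%:R^-1)%:MP * fpsh.

Lemma kahanE :
  (1%:M - half_h *: map_mx (@fpsC _) jacobian) *m \col_i (kahan i - fpsC 'X_i)
  = fpsh *: map_mx (@fpsC _) f.
Proof.
rewrite mulmxBl mul1mx -scalemxAl; apply/colP => i; rewrite !mxE.
apply: fpsP => k.
rewrite /half_h 2!fpscoefB -[X in _ - fpscoef X _]mulrA fpscoefCM !fpscoefhM.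
case: k => [|k]; first by rewrite fpscoefC /= mulr0 subr0 subrr.
rewrite fpscoef_sum !fpscoefC /= subr0; case: k => [|k].
  rewrite expr0 invr1 scale1r mul1mx big1 ?mulr0 ?subr0 // => j _.
  by rewrite !mxE fpscoefCM fpscoefB fpscoefC /= subrr mulr0.
apply/eqP; rewrite subr_eq0; apply/eqP.
rewrite (_ : jacobian ^+ k.+1 = jacobian *m jacobian ^+ k) ?exprS // -mulmxA.
rewrite mxE scaler_sumr mulr_sumr; apply: eq_bigr => j _.
rewrite [map_mx _ _ _ _]mxE [(\col__ _) _ _]mxE fpscoefCM fpscoefB fpscoefC /=.
by rewrite subr0 mul_mpolyC -scalerAr scalerA invfM.
Qed.

(* P o Phi_h = det (D Phi_h) * P, the cofactor being
   det (I + h/2 f'(Phi_h)) / det (I - h/2 f'), with denominators cleared. *)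
Definition kahan_darboux (P : fps {mpoly R[n]}) :=
  \det (1%:M - half_h *: map_mx (@fpsC _) jacobian) * fps_subst kahan P
  = P * \det (1%:M + half_h *: map_mx (mpoly_subst kahan) jacobian).

End VectorField.

(* Main.v *)
From HB Require Import structures.
Require Import Defs.
From mathcomp Require Import all_boot all_order all_fingroup all_algebra.
From mathcomp Require Import boolp reals.
From mathcomp Require Import mpoly ring lra.

Set Implicit Arguments.
Unset Strict Implicit.
Unset Printing Implicit Defensive.

Import GRing.Theory Num.Theory.

Local Open Scope ring_scope.

(* Write P = 1 + h P1 + h^2 P2 + ....  A graph with a self-loop contributes a
   derivative of div f = 0, so P1 = 0 and P2 = gamma(C_2)/2 F(C_2).  When
   tr B = 0, det (1 + t B) = 1 - t^2/2 tr B^2 + t^3/3 tr B^3 + O(t^4), and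
   p(Phi_h) = p + h L p + O(h^2) with L p = sum_k f^k d_k p.  In the coefficient
   of h^3 of the Darboux equation P3 cancels, and what is left is
   L P2 = F(C_3)/12 - L F(C_2)/8; since L F(C_2) = 2 F(T), this says
   F(C_3) = (12 gamma(C_2) + 3) F(T). *)

(** * Expansion of det (1 + t B) *)

(** Congruence modulo the principal ideal of [t]. With a power of a variable in place of [t] it
    serves as O-notation over an arbitrary commutative ring. *)
Definition eqmodr (S : comNzRingType) (t x y : S) := exists c, x = y + t * c.

Lemma eqmodr_refl (S : comNzRingType) (t x : S) : eqmodr t x x.
Proof. by exists 0; rewrite mulr0 addr0. Qed.

Lemma eqmodrD (S : comNzRingType) (t x y x' y' : S) :
  eqmodr t x y -> eqmodr t x' y' -> eqmodr t (x + x') (y + y').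
Proof. by case=> c -> [d ->]; exists (c + d); ring. Qed.

Lemma eqmodrM (S : comNzRingType) (t x y x' y' : S) :
  eqmodr t x y -> eqmodr t x' y' -> eqmodr t (x * x') (y * y').
Proof. by case=> c -> [d ->]; exists (c * y' + y * d + t * c * d); ring. Qed.

Lemma det_eqmodr (S : comNzRingType) (t : S) n (A B : 'M[S]_n) :
  (forall i j, eqmodr t (A i j) (B i j)) -> eqmodr t (\det A) (\det B).
Proof.
move=> eqAB; apply: (big_ind2 (eqmodr t)) => [|x y x' y'|s _].
- exact: eqmodr_refl.
- exact: eqmodrD.
apply: eqmodrM; first exact: eqmodr_refl.
apply: (big_ind2 (eqmodr t)) => // [|x y x' y']; first exact: eqmodr_refl.
exact: eqmodrM.
Qed.

(** In the Leibniz expansion the identity contributes the product of the [1 + t * B i i]. A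
    permutation moving [i] also moves [s i], so its term has two off-diagonal factors, each
    divisible by [t]. *)
Lemma det_addMX (S : comNzRingType) (t : S) n (B : 'M[S]_n) :
  eqmodr (t ^+ 2) (\det (1%:M + t *: B)) (1 + t * \tr B).
Proof.
rewrite /determinant (bigD1 1%g) //= odd_perm1 expr0 mul1r.
rewrite -[X in eqmodr _ _ X]addr0.
apply: eqmodrD.
  rewrite /mxtrace; elim/big_rec2: _ => [|i s x _ [c ->]].
    by rewrite mulr0 addr0; exact: eqmodr_refl.
  rewrite !mxE perm1 eqxx /=.
  by exists (c + B i i * (s + t * c)); ring.
apply: (big_ind (fun x => eqmodr _ x 0)) => [|x y hx hy|s sN1].
- exact: eqmodr_refl.
- by rewrite -[0]addr0; exact: eqmodrD.
have [i siNi] : exists i, s i != i.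
  apply/existsP; rewrite -negb_forall; apply: contra sN1 => /forallP s1.
  by apply/eqP/permP => i; rewrite perm1; exact/eqP.
rewrite (bigD1 i) //= (bigD1 (s i)) //= !mxE.
rewrite eq_sym (negPf siNi) (inj_eq perm_inj) eq_sym (negPf siNi) !add0r.
exists ((-1) ^+ s * (B i (s i) * (B (s i) (s (s i)) *
  \prod_(j | (j != i) && (j != s i)) (1%:M + t *: B) j (s j)))).
move: (_ ^+ _) (B _ _) (B _ _) (\prod_(_ | _) _) => a b c d; ring.
Qed.

Lemma mxtrace_polyC (S : comNzRingType) n (B : 'M[S]_n) :
  \tr (map_mx polyC B) = (\tr B)%:P.
Proof. by rewrite /mxtrace rmorph_sum; apply: eq_bigr => i _; rewrite mxE. Qed.

(** Since (1 + tB)^2 = (1 + 2tB) + t^2 B^2, factoring out 1 + 2tB leaves 1 + t^2 B^2 (1 + 2tB)^-1.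
    Truncating the inverse to 1 - 2tB costs exactly 4 t^4 B^4. *)
Lemma addMX_mulmx_sqr (S : comNzRingType) (t : S) n (B : 'M[S]_n) i j :
  ((1%:M + t *: B) *m (1%:M + t *: B)) i j =
  ((1%:M + (t *+ 2) *: B) *m
     (1%:M + t ^+ 2 *: (B *m B - (t *+ 2) *: (B *m B *m B)))) i j +
  t ^+ 4 * ((B *m B *m B *m B) i j *+ 4).
Proof.
rewrite !(scalerBr, mulmxDl, mulmxDr, mulmxBl, mulmxBr, mul1mx, mulmx1,
  mulmxN) -!(scalemxAl, scalemxAr) !scalerA !mulmxA.
move: (B *m B) (B *m B *m B) (B *m B *m B *m B) => B2 B3 B4.
rewrite !mxE; ring.
Qed.

(* Comparing [det (1 + X B) ^ 2] with [det (1 + 2 X B)] modulo [X ^ 4]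
   determines the coefficients from the first-order expansion alone. *)
Lemma det_addMX_sqr (S : comNzRingType) n (B : 'M[S]_n) (D : {poly S}) :
    D = \det (1%:M + 'X *: map_mx polyC B) ->
  eqmodr ('X^4) (D ^+ 2) ((D \Po ('X *+ 2)) *
    (1 + 'X^2 * ((\tr (B *m B))%:P - 'X *+ 2 * (\tr (B *m B *m B))%:P))).
Proof.
move=> ->; set Bp := map_mx polyC B.
have -> : \det (1%:M + 'X *: Bp) \Po ('X *+ 2) = \det (1%:M + ('X *+ 2) *: Bp).
  rewrite -(det_map_mx (comp_poly ('X *+ 2))); congr (\det _).
  apply/matrixP => i j; rewrite !mxE rmorphD rmorphM /= rmorph_nat.
  by rewrite comp_polyX comp_polyC.
pose N := Bp *m Bp - ('X *+ 2) *: (Bp *m Bp *m Bp).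
have [c] : eqmodr ('X^4) (\det (1%:M + 'X *: Bp) ^+ 2)
    (\det (1%:M + ('X *+ 2) *: Bp) * \det (1%:M + 'X^2 *: N)).
  rewrite expr2 -!det_mulmx; apply: det_eqmodr => i j.
  by exists ((Bp *m Bp *m Bp *m Bp) i j *+ 4); exact: addMX_mulmx_sqr.
(* With ['X^2] as the parameter, the error of the first-order expansion is already a multiple of
   ['X^4]. *)
have [d ->] := det_addMX ('X^2) N.
rewrite /N raddfB /= mxtraceZ -!map_mxM !mxtrace_polyC => ->.
set D2 := \det _; exists (c + D2 * d); ring.
Qed.

(** The expansion is found for the indeterminate ['X], where coefficients can be compared, and then
    evaluated at [t]. Writing D = 1 + aX^2 + bX^3 + O(X^4), the comparison gives 2a = 4a + tr B^2
    and 2b = 8b - 2 tr B^3. The multiples 2 and 6 stay in the statement because [S] need not allow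
    division. *)
Lemma det_addMX_tr0 (S : comNzRingType) (t : S) n (B : 'M[S]_n) : \tr B = 0 ->
  exists d2 d3 c,
    [/\ \det (1%:M + t *: B) = 1 + t ^+ 2 * d2 + t ^+ 3 * d3 + t ^+ 4 * c,
        d2 *+ 2 = - \tr (B *m B) & d3 *+ 6 = \tr (B *m B *m B) *+ 2].
Proof.
move=> trB0; pose D := \det (1%:M + 'X *: map_mx polyC B).
have [D1 DE] : eqmodr ('X^2) D 1.
  have := det_addMX 'X (map_mx polyC B).
  by rewrite mxtrace_polyC trB0 polyC0 mulr0 addr0.
have DtE : \det (1%:M + t *: B) = D.[t].
  rewrite -horner_evalE -(det_map_mx (horner_eval t)); congr (\det _).
  apply/matrixP => i j; rewrite !mxE rmorphD rmorphM /= rmorph_nat.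
  by rewrite !horner_evalE hornerX hornerC.
have D1E : D1 = (D1`_0)%:P + 'X * (D1`_1)%:P + 'X^2 * drop_poly 2 D1.
  apply/polyP => -[|[|i]]; rewrite !(coefD, coefC, coefXM, coefXnM) /=.
  - by rewrite !addr0.
  - by rewrite add0r addr0.
  - by rewrite !add0r coef_drop_poly subSS subn1 addn2.
move: (D1`_0) (D1`_1) (drop_poly 2 D1) D1E => a b q D1E.
exists a, b, q.[t]; have [c] := det_addMX_sqr (erefl D).
rewrite -/D DtE DE D1E; set p2 := \tr (B *m B); set p3 := \tr (B *m B *m B).
have compXn : ('X^2 : {poly S}) \Po ('X *+ 2) = ('X *+ 2) ^+ 2.
  by rewrite !expr2 comp_polyM comp_polyX.
rewrite !(comp_polyD, comp_polyM, comp_polyC, comp_polyX, compXn, rmorph1).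
set q2 := q \Po _ => eqX.
(* [r] is the cofactor of ['X^4] in the difference of the two sides. What remains are the
   coefficients of ['X^2] and ['X^3], which must vanish. *)
pose r := q2 *+ 16 +
  (a%:P *+ 4 + 'X * b%:P *+ 8 + 'X^2 * q2 *+ 16) * (p2%:P - 'X * p3%:P *+ 2)
  + c - q *+ 2 - (a%:P + 'X * b%:P + 'X^2 * q) ^+ 2.
have {}eqX :
    'X^2 * ((a *+ 2 + p2)%:P + 'X * (b *+ 6 - p3 *+ 2)%:P + 'X^2 * r) = 0.
  move/eqP: eqX; rewrite eq_sym -subr_eq0 => /eqP <-.
  rewrite /r !(polyCD, polyCN, polyCMn); ring.
split.
- rewrite !hornerE /=; ring.
- apply/eqP; rewrite -addr_eq0; apply/eqP.
  have := congr1 (fun p : {poly S} => p`_2) eqX.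
  by rewrite !(coefD, coefC, coefXM, coefXnM) /= !addr0.
- apply/eqP; rewrite -subr_eq0; apply/eqP.
  have := congr1 (fun p : {poly S} => p`_3) eqX.
  by rewrite !(coefD, coefC, coefXM, coefXnM) /= add0r addr0.
Qed.

(** * Aromatic functions of low order *)

(** The split index is arbitrary because the vertex carrying a self-loop, whose label must be summed
    on its own, can sit anywhere. *)
Lemma sum_ffun_recl (V : nmodType) (T : finType) N (i : 'I_N.+1)
    (F : {ffun 'I_N.+1 -> T} -> V) :
  \sum_l F l =
  \sum_x \sum_(l : {ffun 'I_N -> T}) F [ffun j => oapp l x (unlift i j)].
Proof.
rewrite exchange_big pair_big /= (reindex (fun p : {ffun 'I_N -> T} * T =>
  [ffun j => oapp p.1 p.2 (unlift i j)])) //=.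
exists (fun l : {ffun 'I_N.+1 -> T} => ([ffun j => l (lift i j)], l i))
  => [[l x]|l] _ /=.
  congr pair; last by rewrite ffunE unlift_none.
  by apply/ffunP => j; rewrite !ffunE liftK.
by apply/ffunP => j; rewrite ffunE; case: unliftP => [k|] -> //=; rewrite ffunE.
Qed.

Lemma sum_ffun0 (V : nmodType) (T : finType) (F : {ffun 'I_0 -> T} -> V) l :
  \sum_l F l = F l.
Proof.
rewrite (bigD1 l) //= big1 ?addr0 // => l' /eqP[].
by apply/ffunP => -[].
Qed.

Lemma sum_ffun2 (V : nmodType) (T : finType) (F : {ffun 'I_2 -> T} -> V) :
  \sum_l F l = \sum_x \sum_y F [ffun i : 'I_2 => nth x [:: x; y] i].
Proof.
rewrite (sum_ffun_recl ord0); apply: eq_bigr => x _.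
rewrite (sum_ffun_recl ord0); apply: eq_bigr => y _.
rewrite (sum_ffun0 _ [ffun=> x]); congr F; apply/ffunP => i; rewrite !ffunE.
case: unliftP => [j|] -> //=; rewrite ffunE.
by case: unliftP => [[]|->].
Qed.

Lemma sum_ffun3 (V : nmodType) (T : finType) (F : {ffun 'I_3 -> T} -> V) :
  \sum_l F l =
  \sum_x \sum_y \sum_z F [ffun i : 'I_3 => nth x [:: x; y; z] i].
Proof.
rewrite (sum_ffun_recl ord0); apply: eq_bigr => x _.
rewrite sum_ffun2; apply: eq_bigr => y _; apply: eq_bigr => z _.
congr F; apply/ffunP => i; rewrite !ffunE.
by case: unliftP => [[[|[|//]] ?]|] -> //=; rewrite ffunE.
Qed.

Section AromaticFunctions.
Variables (R : realType) (n : nat) (f : 'cV[{mpoly R[n]}]_n).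

Lemma elemF_C2 : elemF f C2 = \sum_i \sum_j (f i 0)^`M(j) * (f j 0)^`M(i).
Proof.
rewrite /elemF sum_ffun2; apply: eq_bigr => x _; apply: eq_bigr => y _.
rewrite !big_ord_recl !big_ord0 mulr1 /=.
rewrite !(big_mkcond (fun i => _ == _)) !big_ord_recl !big_ord0 !ffunE /=.
by rewrite !(add0m, addm0) !mderivmU1m.
Qed.

(** The only edge leaving [i] ends at [i], so the label of [i] enters no other factor. Summing over
    that label first produces a derivative of [divergence f]. *)
Lemma elemF_fixpoint N (phi : outgraph N) i :
  divergence f = 0 -> phi i = i -> elemF f phi = 0.
Proof.
case: N phi i => [|N] phi i; first by case: i.
move=> div0 phii; rewrite /elemF (sum_ffun_recl i) exchange_big big1 //= => l _.
(* For [n = 0] the sum is empty. Otherwise [x0] is a frozen label for [i], used wherever the actual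
   label has no influence. *)
case: (pickP 'I_n) => [x0 _|no]; last by rewrite big1 // => x; have := no x.
pose e x : {ffun 'I_N.+1 -> 'I_n} := [ffun j => oapp l x (unlift i j)].
have ei x : e x i = x by rewrite ffunE unlift_none.
have eNi x j : j != i -> e x j = e x0 j.
  by rewrite !ffunE; case: unliftP => [k|] -> //; rewrite eqxx.
(* [M] gathers the edges into [i] other than the loop, and [P] the factors of the other vertices;
   neither depends on the label of [i]. *)
pose M := (\sum_(k < N.+1 | (phi k == i) && (k != i)) U_(e x0 k))%MM.
pose P := \prod_(j < N.+1 | j != i)
  (f (e x0 j) 0)^`M[\sum_(k < N.+1 | phi k == j) U_(e x0 k)].
transitivity (\sum_x (f x 0)^`M(x)^`M[M] * P).
  apply: eq_bigr => x _; rewrite (bigD1 i) //= -/(e x) ei; congr (_ * _).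
    rewrite (bigD1 i) ?phii //= ei mderivmDm mderivmU1m; congr (_^`M[_]).
    by apply: eq_bigr => k /andP[_ kNi]; rewrite eNi.
  apply: eq_bigr => j jNi; rewrite eNi //; congr (_^`M[_]).
  apply: eq_bigr => k /eqP phik; rewrite eNi //.
  by apply: contra jNi => /eqP ki; rewrite -phik ki phii.
by rewrite -mulr_suml -raddf_sum /= -/(divergence f) div0 raddf0 mul0r.
Qed.

Lemma elemF_C3 : elemF f C3 = \sum_i \sum_j \sum_k
  (f i 0)^`M(k) * (f k 0)^`M(j) * (f j 0)^`M(i).
Proof.
rewrite /elemF sum_ffun3; apply: eq_bigr => x _; apply: eq_bigr => y _.
apply: eq_bigr => z _; rewrite !big_ord_recl !big_ord0 mulr1 /=.
rewrite !(big_mkcond (fun i => _ == _)) !big_ord_recl !big_ord0 !ffunE /=.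
rewrite !(add0m, addm0) !mderivmU1m; ring.
Qed.

Lemma elemF_Taroma : elemF f Taroma = \sum_i \sum_j \sum_k
  (f i 0)^`M(j) * (f j 0)^`M(i)^`M(k) * f k 0.
Proof.
rewrite /elemF sum_ffun3; apply: eq_bigr => x _; apply: eq_bigr => y _.
apply: eq_bigr => z _; rewrite !big_ord_recl !big_ord0 mulr1 /=.
rewrite !(big_mkcond (fun i => _ == _)) !big_ord_recl !big_ord0 !ffunE /=.
rewrite -!val_eqE /= !inordK //=.
by rewrite !(add0m, addm0) mderivmDm !mderivmU1m mderivm0m mulrA.
Qed.

Lemma elemF_outgraph0 (phi : outgraph 0) : elemF f phi = 1.
Proof. by rewrite /elemF (sum_ffun0 _ (ffun0 (card_ord 0))) big_ord0. Qed.

Lemma tr_jacobian : \tr (jacobian f) = divergence f.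
Proof. by apply: eq_bigr => i _; rewrite mxE. Qed.

Lemma tr_jacobian2 : \tr (jacobian f *m jacobian f) = elemF f C2.
Proof.
rewrite elemF_C2; apply: eq_bigr => i _; rewrite mxE.
by apply: eq_bigr => j _; rewrite !mxE.
Qed.

Lemma tr_jacobian3 :
  \tr (jacobian f *m jacobian f *m jacobian f) = elemF f C3.
Proof.
rewrite elemF_C3; apply: eq_bigr => i _; rewrite mxE.
apply: eq_bigr => j _; rewrite !mxE mulr_suml.
by apply: eq_bigr => k _; rewrite !mxE.
Qed.

Definition lie_derivative (p : {mpoly R[n]}) := \sum_k p^`M(k) * f k 0.

(** The product rule attaches the new vertex to either vertex of the 2-cycle, and exchanging the two
    cycle labels identifies the two resulting sums. *)
Lemma lie_derivative_C2 : lie_derivative (elemF f C2) = elemF f Taroma *+ 2.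
Proof.
have -> : lie_derivative (elemF f C2) = \sum_i \sum_j \sum_k
    ((f i 0)^`M(j)^`M(k) * (f j 0)^`M(i) * f k 0 +
     (f i 0)^`M(j) * (f j 0)^`M(i)^`M(k) * f k 0).
  rewrite /lie_derivative elemF_C2.
  under eq_bigr do rewrite raddf_sum mulr_suml.
  rewrite exchange_big; apply: eq_bigr => i _ /=.
  under eq_bigr do rewrite raddf_sum mulr_suml.
  rewrite exchange_big; apply: eq_bigr => j _ /=.
  by apply: eq_bigr => k _; rewrite mderivM mulrDl.
rewrite elemF_Taroma mulr2n [X in _ = X + _]exchange_big /=.
rewrite -big_split; apply: eq_bigr => i _; rewrite -big_split.
apply: eq_bigr => j _; rewrite -big_split; apply: eq_bigr => k _ /=.
by rewrite [X in X * f k 0]mulrC.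
Qed.

Lemma outgraph2P (phi : outgraph 2) : phi = C2 \/ exists i, phi i = i.
Proof.
have [/existsP[i /eqP phii]|] := boolP [exists i, phi i == i].
  by right; exists i.
rewrite negb_exists => /forallP phiN; left; apply/ffunP => i.
apply/val_inj; rewrite ffunE /=; move: (phiN i).
by rewrite -val_eqE; case: i (phi i) => [[|[|//]] ?] [[|[|//]] ?].
Qed.

Lemma nb_aut_C2 : nb_aut C2 = 2.
Proof.
(* The successor map of [C2] is the transposition, which commutes with every permutation of two
   points. *)
have -> : nb_aut C2 = #|{perm 'I_2}|; last by rewrite card_Sn.
apply: eq_card => s; rewrite !inE; apply/forallP => i; rewrite !ffunE.
have : s (ordS i) != s i.
  by rewrite (inj_eq perm_inj) -val_eqE; case: i => [[|[|//]] ?].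
rewrite -!val_eqE /=.
by case: (s i) (s _) => [[|[|//]] ?] [[|[|//]] ?].
Qed.

Variable gamma : aromas -> R.
Let P := aromatic_series f gamma.

Lemma aromatic_series0 : fpscoef P 0 = (gamma (aromas_class outgraph0))%:MP.
Proof.
pose a0 := (\pi_(aromas_of_order 0) outgraph0)%qT.
have outgraph_eq (phi psi : outgraph 0) : phi = psi by apply/ffunP => -[].
rewrite /P /= (bigD1 a0) //= big1 => [|a].
  rewrite addr0 elemF_outgraph0 alg_mpolyC.
  rewrite (_ : nb_aut _ = 1%N) ?divr1 //.
  rewrite /nb_aut (eq_card (B := predT)) ?card_Sn // => s.
  by rewrite !inE; apply/forallP => -[].
by rewrite -[a](@generic_quotient.reprK)
  (outgraph_eq (generic_quotient.repr a) outgraph0) eqxx.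
Qed.

Lemma aromatic_series1 : divergence f = 0 -> fpscoef P 1 = 0.
Proof.
move=> div0; rewrite /P /= big1 // => a _.
by rewrite (@elemF_fixpoint _ _ ord0) ?scaler0 //;
  apply: ord_inj; case: (aromas_repr a ord0) => [[]].
Qed.

Lemma aromatic_series2 : divergence f = 0 ->
  fpscoef P 2 = (gamma (aromas_class C2) / 2%:R) *: elemF f C2.
Proof.
move=> div0; pose a0 := (\pi_(aromas_of_order 2) C2)%qT.
(* The representative chosen by the quotient is only known to be isomorphic to [C2], so the
   invariance of [elemF] and [nb_aut] is called on. *)
have iso : isomorphic (aromas_repr a0) C2.
  by apply/generic_quotient.eqmodP; rewrite generic_quotient.reprK.
rewrite /P /= (bigD1 a0) //= big1 => [|a aN].
  by rewrite addr0 (elemF_iso _ iso) (nb_aut_iso iso) nb_aut_C2.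
have [aE|[i /elemF_fixpoint->]] := outgraph2P (aromas_repr a);
  rewrite ?scaler0 //.
by move: aN; rewrite /a0 -aE generic_quotient.reprK eqxx.
Qed.

End AromaticFunctions.

(** * The coefficient of h^3 in the Darboux equation *)

Section FpsConstants.
Variable A : comNzRingType.

Fact fpsC_is_additive : {morph @fpsC A : x y / x - y}.
Proof. by move=> x y; apply: fpsP => -[|k] //=; rewrite subr0. Qed.

Fact fpsC_is_monoid_morphism : monoid_morphism (@fpsC A).
Proof.
split=> // x y; apply: fpsP => k.
by rewrite fpscoefCM !fpscoefC; case: eqP => // _; rewrite mulr0.
Qed.

HB.instance Definition _ :=
  GRing.isZmodMorphism.Build A (fps A) (@fpsC A) fpsC_is_additive.
HB.instance Definition _ :=
  GRing.isMonoidMorphism.Build A (fps A) (@fpsC A) fpsC_is_monoid_morphism.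

Lemma fpscoef_hXM m (a : fps A) k : (k < m)%N -> fpscoef (fpsh ^+ m * a) k = 0.
Proof.
elim: m k => // m IH [|k] ltkm; rewrite exprS -mulrA fpscoefhM //; exact: IH.
Qed.

Lemma fpscoefM3 (a b : fps A) :
  fpscoef (a * b) 3 = fpscoef a 0 * fpscoef b 3 + fpscoef a 1 * fpscoef b 2 +
    fpscoef a 2 * fpscoef b 1 + fpscoef a 3 * fpscoef b 0.
Proof. by rewrite fpscoefM !big_ord_recl big_ord0 /= addr0 !addrA. Qed.

End FpsConstants.

Section FirstOrder.
Variables (R : realType) (n : nat) (f : 'cV[{mpoly R[n]}]_n).

(** The entries of [B] are themselves series in h, so the term in tr B^2 reaches h^3 through the
    linear coefficient of that trace, and the term in tr B^3 through its constant coefficient. *)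
Lemma fpscoef_det_tr0 m (c : R) (B : 'M[fps {mpoly R[n]}]_m) : \tr B = 0 ->
  let D := \det (1%:M + (fpsC c%:MP * fpsh) *: B) in
  [/\ fpscoef D 0 = 1, fpscoef D 1 = 0 &
      fpscoef D 3 = - (c ^+ 2 / 2%:R) *: fpscoef (\tr (B *m B)) 1
        + (c ^+ 3 / 3%:R) *: fpscoef (\tr (B *m B *m B)) 0].
Proof.
move=> trB0; have [d2 [d3 [e [/= -> d2E d3E]]]] :=
  det_addMX_tr0 (fpsC c%:MP * fpsh) trB0.
have coefD (a b : fps {mpoly R[n]}) k :
  fpscoef (a + b) k = fpscoef a k + fpscoef b k by [].
have coefX a k l : fpscoef ((fpsC c%:MP * fpsh) ^+ k * a) l =
    c ^+ k *: fpscoef (fpsh ^+ k * a) l.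
  rewrite exprMn -rmorphXn /= -mulrA fpscoefCM -mul_mpolyC; congr (_ * _).
  by rewrite rmorphXn.
have coef1 k :
  fpscoef (1 : fps {mpoly R[n]}) k = if k == 0%N then 1 else 0 by [].
rewrite !coefD !coefX !coef1 /=; split.
- by rewrite !fpscoef_hXM // !scaler0 !addr0.
- by rewrite !fpscoef_hXM // !scaler0 !addr0.
rewrite [fpscoef (fpsh ^+ 4 * _) _]fpscoef_hXM // scaler0 addr0 add0r.
rewrite !exprS !expr0 !mulr1 -!mulrA !fpscoefhM.
have d2E1 := congr1 (fun a => fpscoef a 1) d2E.
have d3E0 := congr1 (fun a => fpscoef a 0) d3E.
rewrite !(mulrS, addr0, mulr0n) !coefD /= in d2E1 d3E0.
(* Monomial coefficients live in the field [R], where the factors 2 and 6 can be divided out. *)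
apply/mpolyP => k; move/mpolyP/(_ k): d2E1; move/mpolyP/(_ k): d3E0.
rewrite !(mcoeffD, mcoeffN, mcoeffZ) => d3k d2k.
have -> : (fpscoef (\tr (B *m B)) 1)@_k = (fpscoef d2 1)@_k * - 2%:R by lra.
have -> : (fpscoef (\tr (B *m B *m B)) 0)@_k = (fpscoef d3 0)@_k * 3%:R by lra.
by field.
Qed.

Let subst := @mpoly_subst R n (kahan f).

(** Displaying the coefficient map as a composite of ring morphisms lets [subst] be treated as a
    ring morphism. *)
Lemma mpoly_substE : subst = mmap (@fpsC _ \o @mpolyC n R) (kahan f).
Proof. by []. Qed.

Lemma lie_derivativeD p q :
  lie_derivative f (p + q) = lie_derivative f p + lie_derivative f q.
Proof.
by rewrite -big_split; apply: eq_bigr => k _; rewrite mderivD mulrDl.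
Qed.

Lemma lie_derivativeM p q :
  lie_derivative f (p * q) = lie_derivative f p * q + p * lie_derivative f q.
Proof.
rewrite /lie_derivative mulr_suml mulr_sumr -big_split; apply: eq_bigr => k _.
by rewrite mderivM /=; ring.
Qed.

Lemma lie_derivativeC c : lie_derivative f c%:MP = 0.
Proof. by rewrite /lie_derivative big1 // => k _; rewrite mderivC mul0r. Qed.

Lemma lie_derivativeX i : lie_derivative f 'X_i = f i 0.
Proof.
rewrite /lie_derivative (bigD1 i) //= big1 => [|k /negPf kNi].
  rewrite mderivX mnm1E eqxx -{1}[U_(i)%MM]add0m addmK.
  by rewrite mpolyX0 scale1r mul1r addr0.
by rewrite mderivX mnm1E eq_sym kNi scale0r mul0r.
Qed.

(** The Kahan map begins with x + h f(x). Substitution is a ring morphism and [lie_derivative] obeys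
    the Leibniz rule, so the claim passes from constants and variables to all polynomials. *)
Lemma fpscoef_subst_kahan p :
  fpscoef (subst p) 0 = p /\ fpscoef (subst p) 1 = lie_derivative f p.
Proof.
pose good p :=
  fpscoef (subst p) 0 = p /\ fpscoef (subst p) 1 = lie_derivative f p.
have goodC c : good c%:MP.
  by rewrite /good mpoly_substE mmapC /= lie_derivativeC.
have goodD p1 p2 : good p1 -> good p2 -> good (p1 + p2).
  rewrite /good mpoly_substE rmorphD /= => -[p10 p11] [p20 p21].
  by rewrite p10 p11 p20 p21 lie_derivativeD.
have goodM p1 p2 : good p1 -> good p2 -> good (p1 * p2).
  rewrite /good mpoly_substE rmorphM /= => -[p10 p11] [p20 p21].
  rewrite !fpscoefM !big_ord_recl !big_ord0 /= !addr0 p10 p11 p20 p21.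
  by rewrite lie_derivativeM addrC.
have goodX i : good 'X_i.
  rewrite /good mpoly_substE mmapX mmap1U lie_derivativeX /=.
  by rewrite expr0 invr1 scale1r mul1mx.
rewrite -/(good p); elim/mpolyind: p => [|c m p _ _ IH].
  by rewrite -(mpolyC0 n R); exact: goodC.
apply: (goodD) => //; rewrite -mul_mpolyC; apply: (goodM) => //.
rewrite mpolyXE_id; apply: (big_ind good) => [|p1 p2|i _];
  [exact: goodC | exact: goodM |].
elim: (m i) => [|k IHk]; first exact: goodC.
by rewrite exprS; apply: goodM.
Qed.

Lemma kahan_darboux_coef3 (P : fps {mpoly R[n]}) :
    divergence f = 0 -> kahan_darboux f P ->
    fpscoef P 0 = 1 -> fpscoef P 1 = 0 ->
  lie_derivative f (fpscoef P 2) *+ 12 = elemF f C3 - elemF f Taroma *+ 3.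
Proof.
move=> div0 darboux P0 P1.
pose Q := fps_subst (kahan f) P.
have subst0 : subst 0 = 0 by rewrite mpoly_substE rmorph0.
have subst1 : subst 1 = 1 by rewrite mpoly_substE rmorph1.
have Q0 : fpscoef Q 0 = 1 by rewrite /= big_ord1 P0 -/subst subst1.
have Q1 : fpscoef Q 1 = 0.
  rewrite /= !big_ord_recl big_ord0 /= /bump /= P0 P1.
  by rewrite -/subst subst1 subst0 !addr0.
have Q3 : fpscoef Q 3 = lie_derivative f (fpscoef P 2) + fpscoef P 3.
  rewrite /= !big_ord_recl big_ord0 /bump /= P0 P1 -/subst subst1 subst0.
  rewrite (fpscoef_subst_kahan (fpscoef P 2)).2.
  by rewrite (fpscoef_subst_kahan (fpscoef P 3)).1 addr0 !add0r.
(* Absorbing the sign into the constant lets [fpscoef_det_tr0] expand both determinants, with [c]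
   equal to -1/2 and 1/2. *)
have halfN : - half_h R n = fpsC (- 2%:R^-1)%:MP * fpsh.
  by rewrite /half_h -mulNr -rmorphN -mpolyCN.
have := congr1 (fun a => fpscoef a 3) darboux.
rewrite -scaleNr halfN.
set J := map_mx (@fpsC _) (jacobian f).
have trJ0 : \tr J = 0 by rewrite trace_map_mx tr_jacobian div0 rmorph0.
have [D0 D1] := fpscoef_det_tr0 (- 2%:R^-1) trJ0.
rewrite -!map_mxM !trace_map_mx tr_jacobian2 tr_jacobian3 /=.
(* The entries of [J] are constant in h, so the linear coefficient of its squared trace term is zero
   and only the multiple of [elemF f C3] survives. *)
rewrite scaler0 add0r => D3.
set JPhi := map_mx _ (jacobian f).
have JPhiE : JPhi =
  map_mx (mmap (@fpsC _ \o @mpolyC n R) (kahan f)) (jacobian f) by [].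
have trJPhi0 : \tr JPhi = 0.
  by rewrite JPhiE trace_map_mx tr_jacobian div0 rmorph0.
have [E0 E1] := fpscoef_det_tr0 (2%:R^-1) trJPhi0.
rewrite JPhiE -!map_mxM !trace_map_mx tr_jacobian2 tr_jacobian3 -JPhiE /=.
rewrite -mpoly_substE (fpscoef_subst_kahan _).1 (fpscoef_subst_kahan _).2.
rewrite lie_derivative_C2 => E3.
(* All linear coefficients vanish, so no second-order coefficient of a determinant or of [Q] enters:
   -F(C_3)/24 + L P2 + P3 = P3 - F(T)/4 + F(C_3)/24. *)
rewrite !fpscoefM3 -/Q Q0 Q1 Q3 P0 P1 D0 D1 D3 E0 E1 E3 => /mpolyP eq3.
apply/mpolyP => k; move: (eq3 k).
rewrite !(mul1r, mulr1, mul0r, mulr0, addr0, mcoeffD, mcoeffN, mcoeffZ,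
  mcoeffMn).
lra.
Qed.

Lemma elemF_C3_eq (gamma : aromas -> R) :
    divergence f = 0 -> kahan_darboux f (aromatic_series f gamma) ->
    gamma (aromas_class outgraph0) = 1 ->
  elemF f C3 = (12%:R * gamma (aromas_class C2) + 3%:R) *: elemF f Taroma.
Proof.
move=> div0 darboux gamma1.
have := kahan_darboux_coef3 div0 darboux _ (aromatic_series1 gamma div0).
rewrite aromatic_series0 gamma1 aromatic_series2 // => /(_ erefl).
(* The 2 gained here cancels the automorphism count of [C2], so L P2 is gamma(C_2) F(T). *)
have -> c : lie_derivative f (c *: elemF f C2) = c *: (elemF f Taroma *+ 2).
  rewrite -mul_mpolyC lie_derivativeM lie_derivativeC mul0r add0r.
  by rewrite lie_derivative_C2 mul_mpolyC.
move=> /mpolyP eqC3; apply/mpolyP => k; move: (eqC3 k).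
rewrite !(mcoeffD, mcoeffN, mcoeffZ, mcoeffMn); lra.
Qed.

End FirstOrder.

Theorem theorem2 (R : realType) (n : nat) (f : 'cV[{mpoly R[n]}]_n)
    (f_quadratic : quadratic f) (f_div0 : divergence f = 0)
    (gamma : aromas -> R)
    (gamma_darboux : kahan_darboux f (aromatic_series f gamma))
    (gamma1 : gamma (aromas_class outgraph0) = 1) :
  (exists alpha : R, forall x : 'I_n -> R,
      (elemF f C3).@[x] = alpha * (elemF f Taroma).@[x]) /\
  (forall alpha : R,
      (forall x : 'I_n -> R,
         (elemF f C3).@[x] = alpha * (elemF f Taroma).@[x]) ->
      ((forall x : 'I_n -> R, (elemF f C3).@[x] = 0) /\
       (forall x : 'I_n -> R, (elemF f Taroma).@[x] = 0)) \/
      gamma (aromas_class C2) = (alpha - 3%:R) / 12%:R).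
Proof.
have C3E := elemF_C3_eq f_div0 gamma_darboux gamma1.
split=> [|alpha C3alpha].
  by exists (12%:R * gamma (aromas_class C2) + 3%:R) => x; rewrite C3E mevalZ.
(* If F(T) vanishes everywhere, so does F(C_3). Otherwise, at a point where F(T) is nonzero,
   cancelling it equates [alpha] with 12 gamma(C_2) + 3. *)
have [T0|/existsNP[x /eqP Tx]] := pselect (forall x, (elemF f Taroma).@[x] = 0).
  by left; split=> // x; rewrite C3alpha T0 mulr0.
right; have := C3alpha x; rewrite C3E mevalZ => /(mulIf Tx); lra.
Qed.
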